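(* Let $k\ge 3$ and let $f$ be a three-translate on $\{1,\dots,3k\}$ which is not a permutation. Then $\gamma(C(C_{3k},f))=2k=2\gamma(C_{3k})$ if and only if $C(C_{3k},f)$ is isomorphic to $C(C_{3k},(1,1,2))$, to $C(C_{3k},(1,2,1))$, or to $C(C_{3k},(1,3,1))$.
   Context: Let $G_1,G_2$ be disjoint copies of $C_{3k}$ with vertices $u_1,\dots,u_{3k}$ and $v_1,\dots,v_{3k}$ labeled cyclically; a function $f:\{1,\dots,3k\}\to\{1,\dots,3k\}$ is identified with the map $u_i\mapsto v_{f(i)}$. The functigraph $C(C_{3k},f)$ has vertex set $V(G_1)\cup V(G_2)$ and edge set $E(G_1)\cup E(G_2)\cup\{u_iv_{f(i)}: 1\le i\le 3k\}$. $f$ is a three-translate if $f(x+3i)=f(x)+3i$ for $x\in\{1,2,3\}$ and $i\in\{0,\dots,k-1\}$; a three-translate is determined by $\widetilde f=f|_{\{1,2,3\}}$, and $C(C_{3k},(a_1,a_2,a_3))$ denotes $C(C_{3k},f)$ for the three-translate $f$ with $f(1)=a_1,f(2)=a_2,f(3)=a_3$. $\gamma$ denotes domination number. *)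

(* Defs.v *)
From mathcomp Require Import all_boot zify.

Set Implicit Arguments.
Unset Strict Implicit.
Unset Printing Implicit Defensive.

Record sgraph := SGraph {
  svertex :> finType;
  sedge : rel svertex;
  sedge_sym : symmetric sedge;
  sedge_irr : irreflexive sedge
}.

Definition sgraph_iso (G H : sgraph) : Prop :=
  exists2 h : G -> H, bijective h & {mono h : x y / sedge x y}.

Definition dominating (G : sgraph) (D : {set G}) : bool :=
  [forall v, (v \in D) || [exists u in D, sedge u v]].

Lemma dominatingT (G : sgraph) : dominating [set: G].
Proof. by apply/forallP=> v; rewrite inE. Qed.

Definition domination_number (G : sgraph) : nat :=
  #|[arg min_(D < [set: G] | dominating D) #|D|]|.

(* The vertices of C_n are labelled 1, ..., n: the vertex i : 'I_n carries the
   label i.+1.  This is the cycle C_n only for n >= 3. *)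
Definition label (n : nat) (i : 'I_n) : nat := i.+1.

Section Cycle.
Variable n : nat.

Definition cycle_rel : rel 'I_n := fun i j =>
  (i != j) && ((j == ordS i) || (i == ordS j)).

Lemma cycle_rel_sym : symmetric cycle_rel.
Proof. by move=> i j; rewrite /cycle_rel eq_sym orbC. Qed.

Lemma cycle_rel_irr : irreflexive cycle_rel.
Proof. by move=> i; rewrite /cycle_rel eqxx. Qed.

Definition cycle_graph : sgraph := SGraph cycle_rel_sym cycle_rel_irr.

End Cycle.

(* [inl x] is the copy of x in G_1 and [inr x] its copy in G_2. *)
Section Functigraph.
Variables (G : sgraph) (f : G -> G).

Definition functigraph_rel : rel (G + G)%type := fun x y =>
  match x, y with
  | inl u, inl u' => sedge u u'
  | inr v, inr v' => sedge v v'
  | inl u, inr v => v == f u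
  | inr v, inl u => v == f u
  end.

Lemma functigraph_rel_sym : symmetric functigraph_rel.
Proof. by move=> [u|v] [u'|v'] //=; exact: sedge_sym. Qed.

Lemma functigraph_rel_irr : irreflexive functigraph_rel.
Proof. by move=> [u|v] /=; exact: sedge_irr. Qed.

Definition functigraph : sgraph :=
  SGraph functigraph_rel_sym functigraph_rel_irr.

End Functigraph.

Definition cycle_functigraph (n : nat) (f : 'I_n -> 'I_n) : sgraph :=
  @functigraph (cycle_graph n) f.

(* The equation is between labels as integers, not modulo 3k.  As f takes its
   labels in {1, ..., 3k}, taking i = k - 1 forces f to map {1, 2, 3} to itself;
   see [three_translate_le3]. *)
Definition three_translate (k : nat) (f : 'I_(3 * k) -> 'I_(3 * k)) : Prop :=
  forall (x y : 'I_(3 * k)) (i : nat),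
    1 <= label x <= 3 -> i < k -> label y = label x + 3 * i ->
    label (f y) = label (f x) + 3 * i.

(* The vertex y = x + 3i with x < 3 carries the label (x + 1) + 3i, so its image
   carries the label a_(x+1) + 3i.  The default value y of [insubd] is not used
   when a1, a2, a3 are in {1, 2, 3}. *)
Definition three_translate_of (k a1 a2 a3 : nat) :
    'I_(3 * k) -> 'I_(3 * k) := fun y =>
  insubd y (nth 0 [:: a1; a2; a3] (y %% 3) + 3 * (y %/ 3)).-1.

Lemma three_translate_le3 (k : nat) (f : 'I_(3 * k) -> 'I_(3 * k)) :
  three_translate f ->
  forall x : 'I_(3 * k), label x <= 3 -> label (f x) <= 3.
Proof.
move=> ft x x3; have lt := ltn_ord x; rewrite /label in x3.
have yP : x + 3 * k.-1 < 3 * k by lia.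
have k_gt0 : k.-1 < k by lia.
have := ft x (Ordinal yP) k.-1 x3 k_gt0 erefl.
by have := ltn_ord (f (Ordinal yP)); rewrite /label; lia.
Qed.

Lemma three_translate_ofP (k a1 a2 a3 : nat) (f : 'I_(3 * k) -> 'I_(3 * k)) :
  1 <= a1 <= 3 -> 1 <= a2 <= 3 -> 1 <= a3 <= 3 ->
  (three_translate f /\
   (forall x : 'I_(3 * k), label x <= 3 ->
      label (f x) = nth 0 [:: a1; a2; a3] (label x).-1)) <->
  f =1 @three_translate_of k a1 a2 a3.
Proof.
move=> a1P a2P a3P; set s := [:: a1; a2; a3].
have sP x : x < 3 -> 1 <= nth 0 s x <= 3 by case: x => [|[|[|]]].
have E (y : 'I_(3 * k)) :
    label (three_translate_of a1 a2 a3 y) = nth 0 s (y %% 3) + 3 * (y %/ 3).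
  have r3 : y %% 3 < 3 by rewrite ltn_mod.
  have := sP _ r3; have := divn_eq y 3; have := ltn_ord y.
  by rewrite /label /three_translate_of val_insubd -/s; case: ifP; lia.
split=> [[ft f3] y | fE].
  apply/val_inj/succn_inj; rewrite -[LHS]/(label (f y)) -[RHS]/(label _) E.
  have r3 : y %% 3 < 3 by rewrite ltn_mod.
  have yD := divn_eq y 3; have ylt := ltn_ord y.
  have xP : y %% 3 < 3 * k by lia.
  have i_lt : y %/ 3 < k by lia.
  have yE : label y = label (Ordinal xP) + 3 * (y %/ 3).
    by rewrite /label /=; lia.
  by rewrite (ft (Ordinal xP) y _ r3 i_lt yE) f3.
split=> [x y i x3 _ | x x3]; rewrite !fE !E; rewrite /label /= in x3 *.
  move=> yE; have -> : y = i * 3 + x :> nat by lia.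
  by rewrite modnMDl divnMDl // (divn_small x3); lia.
by rewrite (divn_small x3) (modn_small x3); lia.
Qed.

(* Main.v *)
Require Import Defs.
From mathcomp Require Import all_boot zify.

(* Cut both cycles into k blocks of 3 consecutive vertices. As f maps block i of
   the first cycle into block i of the second, domination of a block only depends
   on its 6 vertices and on the 4 outer vertices next to it.

   Lower bound: for (1,1,2), (1,2,1) and (1,3,1) there is a potential on the cuts
   between consecutive blocks such that the number of chosen vertices in a block
   exceeds 2 by at least the gain of potential across it; going around the cycle
   the gains cancel.

   Conversely, up to rotating and reflecting the two cycles, a non-bijective f is
   one of these three or has a dominating set with 5 vertices in three consecutive
   blocks and at most 2 in each other block. *)

Set Implicit Arguments.
Unset Strict Implicit.
Unset Printing Implicit Defensive.

(** * Domination number and graph isomorphism *)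

Lemma domination_number_leq (G : sgraph) (D : {set G}) :
  dominating D -> domination_number G <= #|D|.
Proof.
move=> domD; rewrite /domination_number.
by case: arg_minnP => [|A _ minA]; [exact: dominatingT | exact: minA].
Qed.

Lemma domination_number_witness (G : sgraph) :
  exists2 D : {set G}, dominating D & #|D| = domination_number G.
Proof.
rewrite /domination_number.
by case: arg_minnP => [|A domA _]; [exact: dominatingT | exists A].
Qed.

Lemma sgraph_iso_sym (G H : sgraph) : sgraph_iso G H -> sgraph_iso H G.
Proof.
case=> h [h' hK h'K] hE; exists h'; first by exists h.
by move=> x y; rewrite -hE !h'K.
Qed.

Lemma sgraph_iso_trans (G H K : sgraph) :
  sgraph_iso G H -> sgraph_iso H K -> sgraph_iso G K.
Proof.
case=> h hB hE [g gB gE]; exists (g \o h); first exact: bij_comp.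
by move=> x y; rewrite /= gE hE.
Qed.

Lemma domination_number_iso_leq (G H : sgraph) :
  sgraph_iso G H -> domination_number H <= domination_number G.
Proof.
case=> h hB hE; have [D domD <-] := domination_number_witness G.
rewrite -(card_imset (mem D) (bij_inj hB)); apply: domination_number_leq.
apply/forallP=> v; have [h' _ h'K] := hB; rewrite -(h'K v).
rewrite (mem_imset _ _ (bij_inj hB)).
have /orP[->//|/exists_inP[u uD uv]] := forallP domD (h' v).
by apply/orP; right; apply/exists_inP; exists (h u); rewrite ?hE ?imset_f.
Qed.

Lemma domination_number_iso (G H : sgraph) :
  sgraph_iso G H -> domination_number G = domination_number H.
Proof.
move=> GH; apply/eqP; rewrite eqn_leq !domination_number_iso_leq //.
exact: sgraph_iso_sym.
Qed.

Lemma functigraph_iso (G H : sgraph) (f : G -> G) (g : H -> H) (a b : G -> H) :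
  bijective a -> {mono a : x y / sedge x y} ->
  bijective b -> {mono b : x y / sedge x y} ->
  (forall x, b (f x) = g (a x)) ->
  sgraph_iso (functigraph f) (functigraph g).
Proof.
move=> [a' aK a'K] aE [b' bK b'K] bE bf.
exists (fun x => match x with inl u => inl (a u) | inr v => inr (b v) end).
  exists (fun x => match x with inl u => inl (a' u) | inr v => inr (b' v) end).
    by case=> x; rewrite ?aK ?bK.
  by case=> x; rewrite ?a'K ?b'K.
by case=> x [] y //=; rewrite -?bf ?(inj_eq (can_inj bK)).
Qed.

(** * Rotations and reflections of the cycle, and block form of three-translates *)

Lemma cycle_rel_ordS n : {mono @ordS n : x y / cycle_rel x y}.
Proof. by move=> x y; rewrite /cycle_rel !(inj_eq (@ordS_inj n)). Qed.

(** A reflection conjugates the successor to the predecessor; this is what makes it preserve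
    adjacency. *)
Lemma ordS_rev_ord n (x : 'I_n) : ordS (rev_ord (ordS x)) = rev_ord x.
Proof.
apply/val_inj=> /=; have xn := ltn_ord x.
have [->|x_lt] : x.+1 = n \/ x.+1 < n by lia.
  by rewrite modnn; case: n x xn => // n x xn; rewrite subn1 /= modnn subnn.
by rewrite (modn_small x_lt) modn_small; lia.
Qed.

Lemma cycle_rel_rev_ord n : {mono @rev_ord n : x y / cycle_rel x y}.
Proof.
have E (x y : 'I_n) : (rev_ord y == ordS (rev_ord x)) = (x == ordS y).
  rewrite -(ordS_rev_ord y) (inj_eq (@ordS_inj n)).
  by rewrite (inj_eq rev_ord_inj) eq_sym.
by move=> x y; rewrite /cycle_rel !E (inj_eq rev_ord_inj) orbC.
Qed.

(* The three labels in [b] are shifted down by one. *)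
Definition blockwise (k : nat) (b : seq nat) (f : 'I_(3 * k) -> 'I_(3 * k)) :=
  forall y, f y = nth 0 b (y %% 3) + 3 * (y %/ 3) :> nat.

(** The first block is mapped into itself, so its three values determine how every block is mapped
    into the block of the same index. *)
Lemma blockwise_three_translate k (f : 'I_(3 * k) -> 'I_(3 * k)) :
  three_translate f ->
  exists b0 b1 b2, [/\ b0 < 3, b1 < 3, b2 < 3 & blockwise [:: b0; b1; b2] f].
Proof.
move=> ft; case: k f ft => [|k] f ft.
  (* For k = 0 there are no vertices and any three values do. *)
  by exists 0, 0, 0; split=> // -[].
have lt3 i : i < 3 -> i < 3 * k.+1 by lia.
pose c i (i3 : i < 3) := Ordinal (lt3 i i3).
have le3 i i3 : f (c i i3) < 3 by apply: three_translate_le3.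
exists (f (c 0 isT)), (f (c 1 isT)), (f (c 2 isT)); split=> // y.
have r3 : y %% 3 < 3 by rewrite ltn_mod.
have yk : y %/ 3 < k.+1 by have := ltn_ord y; lia.
have yE : label y = label (c _ r3) + 3 * (y %/ 3) by rewrite /label /=; lia.
have := ft (c _ r3) y _ r3 yk yE; rewrite /label => fy.
have -> : f y = f (c _ r3) + 3 * (y %/ 3) :> nat by lia.
congr (_ + _); move: (y %% 3) r3 {yE fy}.
by case=> [|[|[|//]]] r3 /=; congr (val (f _)); apply: val_inj.
Qed.

Lemma three_translate_of_blockwise k a1 a2 a3 :
  1 <= a1 <= 3 -> 1 <= a2 <= 3 -> 1 <= a3 <= 3 ->
  blockwise [:: a1.-1; a2.-1; a3.-1] (@three_translate_of k a1 a2 a3).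
Proof.
move=> a1P a2P a3P y; rewrite /three_translate_of val_insubd.
have := divn_eq y 3; have := ltn_ord y; have : y %% 3 < 3 by rewrite ltn_mod.
by move: (y %% 3) => [|[|[|//]]] _ /=; case: ifP; lia.
Qed.

Lemma blockwise_inj k b f :
  @blockwise k b f -> all (gtn 3) b -> size b = 3 -> uniq b -> injective f.
Proof.
move=> fb b3 bs bu x y /(congr1 val) /=; rewrite !fb => xy.
have n3 i : nth 0 b (i %% 3) < 3.
  by apply: (allP b3); rewrite mem_nth // bs ltn_mod.
have dE : x %/ 3 = y %/ 3 by have := n3 x; have := n3 y; lia.
have /eqP : nth 0 b (x %% 3) = nth 0 b (y %% 3) by lia.
rewrite nth_uniq ?bs ?ltn_mod // => /eqP mE.
by apply: val_inj; rewrite /= (divn_eq x 3) (divn_eq y 3) dE mE.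
Qed.

Lemma cycle_functigraph_iso n (f g a b : 'I_n -> 'I_n) :
  bijective a -> {mono a : x y / cycle_rel x y} ->
  bijective b -> {mono b : x y / cycle_rel x y} ->
  (forall x, b (f x) = g (a x)) ->
  sgraph_iso (cycle_functigraph f) (cycle_functigraph g).
Proof. exact: (@functigraph_iso (cycle_graph n) (cycle_graph n)). Qed.

Lemma div3_block i r : r < 3 -> (3 * i + r) %/ 3 = i.
Proof. by move=> r3; rewrite mulnC divnMDl // divn_small // addn0. Qed.

Lemma mod3_block i r : r < 3 -> (3 * i + r) %% 3 = r.
Proof. by move=> r3; rewrite mulnC modnMDl modn_small. Qed.

(** * Isomorphisms between functigraphs given in block form *)

Section BlockwiseIso.
Variables (k : nat).
Hypothesis k_gt0 : 0 < k.
Implicit Types f g : 'I_(3 * k) -> 'I_(3 * k).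

Lemma blockwise_iso_eq b f g :
  blockwise b f -> blockwise b g ->
  sgraph_iso (cycle_functigraph f) (cycle_functigraph g).
Proof.
move=> fb gb; apply: (cycle_functigraph_iso (a := id) (b := id)) => //.
- by exists id.
- by exists id.
by move=> x; apply: val_inj; rewrite /= fb gb.
Qed.

(** Only the second cycle is rotated, by one step. Values below 2 stay inside their block. *)
Lemma blockwise_iso_shift (b0 b1 b2 : nat) f g :
  b0 < 2 -> b1 < 2 -> b2 < 2 ->
  blockwise [:: b0; b1; b2] f -> blockwise [:: b0.+1; b1.+1; b2.+1] g ->
  sgraph_iso (cycle_functigraph f) (cycle_functigraph g).
Proof.
move=> b0P b1P b2P fb gb.
apply: (cycle_functigraph_iso (a := id) (b := @ordS (3 * k))) => //.
- by exists id.
- exact: ordS_bij.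
- exact: cycle_rel_ordS.
move=> x; apply: val_inj; rewrite /= fb gb.
have r3 : x %% 3 < 3 by rewrite ltn_mod.
have := ltn_ord x; have := divn_eq x 3.
by case: (x %% 3) r3 => [|[|[|//]]] _ /= xE x_lt; rewrite modn_small; lia.
Qed.

(** Both cycles are reflected: block i becomes block k - 1 - i, and positions as well as values r
    become 2 - r. *)
Lemma blockwise_iso_rev (b0 b1 b2 : nat) f g :
  b0 < 3 -> b1 < 3 -> b2 < 3 ->
  blockwise [:: b0; b1; b2] f -> blockwise [:: 2 - b2; 2 - b1; 2 - b0] g ->
  sgraph_iso (cycle_functigraph f) (cycle_functigraph g).
Proof.
move=> b0P b1P b2P fb gb.
apply: (cycle_functigraph_iso (a := @rev_ord (3 * k))
                              (b := @rev_ord (3 * k))) => //.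
- exact: inv_bij (@rev_ordK _).
- exact: cycle_rel_rev_ord.
- exact: inv_bij (@rev_ordK _).
- exact: cycle_rel_rev_ord.
move=> x; apply: val_inj; rewrite /= fb gb /=.
have r3 : x %% 3 < 3 by rewrite ltn_mod.
have x_lt := ltn_ord x; have xE := divn_eq x 3.
have -> : 3 * k - x.+1 = (k - (x %/ 3).+1) * 3 + (2 - x %% 3) by lia.
have r3' : 2 - x %% 3 < 3 by lia.
rewrite modnMDl divnMDl // (divn_small r3') (modn_small r3').
have q_lt : x %/ 3 < k by lia.
by case: (x %% 3) r3 xE {r3'} => [|[|[|//]]] _ xE /=; lia.
Qed.

(** The first cycle is rotated by one step and the second by two, which moves the block boundaries:
    position 2 and its image, at position 1, both land at position 0 of the next block. *)
Lemma blockwise_iso_rot f g :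
  blockwise [:: 0; 0; 1] f -> blockwise [:: 0; 2; 2] g ->
  sgraph_iso (cycle_functigraph f) (cycle_functigraph g).
Proof.
move=> fb gb.
apply: (cycle_functigraph_iso (a := @ordS (3 * k))
                        (b := fun x => ordS (@ordS (3 * k) x))) => //.
- exact: ordS_bij.
- exact: cycle_rel_ordS.
- by apply: bij_comp; exact: ordS_bij.
- by move=> x y; rewrite /= !cycle_rel_ordS.
move=> x; apply: val_inj; rewrite /= fb gb /=.
have r3 : x %% 3 < 3 by rewrite ltn_mod.
have x_lt := ltn_ord x; have xE := divn_eq x 3.
have q_lt : x %/ 3 < k by lia.
(* Only the last vertex wraps around; it and its image both go to vertex 0. *)
have [xL|xS] : x.+1 = 3 * k \/ x.+1 < 3 * k by lia.
  have -> : nth 0 [:: 0; 0; 1] (x %% 3) + 3 * (x %/ 3) = x.-1.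
    by case: (x %% 3) r3 xE => [|[|[|//]]] _ xE /=; lia.
  by rewrite xL modnn prednK; [rewrite (modn_small x_lt) xL modnn | lia].
rewrite (modn_small xS) modn_small; last first.
  by case: (x %% 3) r3 xE => [|[|[|//]]] _ xE; rewrite modn_small /=; lia.
case: (x %% 3) r3 xE => [|[|[|//]]] _ xE; rewrite modn_small /=; try lia.
- have -> : x.+1 = 3 * (x %/ 3) + 1 by lia.
  by rewrite mod3_block // div3_block //=; lia.
- have -> : x.+1 = 3 * (x %/ 3) + 2 by lia.
  by rewrite mod3_block // div3_block //=; lia.
have -> : x.+1 = 3 * (x %/ 3).+1 + 0 by lia.
by rewrite mod3_block // div3_block //=; lia.
Qed.

End BlockwiseIso.

(** * Domination as a local condition on blocks *)

(** [p] and [q] are the membership bits of five consecutive vertices in each cycle: a block with one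
    neighbour on either side. Position r of the block has index r + 1 in them. *)
Definition block_dominated (b : seq nat) (p q : seq bool) : bool :=
  all (fun r =>
    [|| nth false p r, nth false p r.+1, nth false p r.+2
      | nth false q (nth 0 b r).+1] &&
    [|| nth false q r, nth false q r.+1, nth false q r.+2
      | has (fun t => (nth 0 b t == r) && nth false p t.+1) (iota 0 3)])
  (iota 0 3).

(** For n > 1 no vertex is its own successor, so the inequality in [cycle_rel] is automatic. *)
Lemma cycle_relE n (x y : 'I_n) : 1 < n ->
  cycle_rel x y = (x == ord_pred y) || (x == ordS y).
Proof.
move=> n1; rewrite /cycle_rel (eq_sym y).
have SP : (ordS x == y) = (x == ord_pred y).
  exact: can2_eq (@ordSK n) (@ord_predK n) _ _.
rewrite SP; case: (eqVneq x y) => //= xy.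
have S_neq : x != ordS x.
  apply/eqP=> /(congr1 val) /=; have x_lt := ltn_ord x.
  have [xL|xS] : x.+1 = n \/ x.+1 < n by lia.
    by rewrite xL modnn; lia.
  by rewrite modn_small; lia.
by rewrite -SP -xy (eq_sym (ordS x)) (negPf S_neq).
Qed.

Section Domination.
Variables (k : nat) (k_gt0 : 0 < k).
Variables (b : seq nat) (f : 'I_(3 * k) -> 'I_(3 * k)).
Hypotheses (b_size : size b = 3) (b_lt3 : all (gtn 3) b) (fb : blockwise b f).

Let n_gt0 : 0 < 3 * k. Proof. by lia. Qed.
Let n_gt1 : 1 < 3 * k. Proof. by lia. Qed.

(** Periodic indexing by all natural numbers lets windows run past the end of the cycle without a
    case distinction. *)
Definition cyc (j : nat) : 'I_(3 * k) := Ordinal (ltn_pmod j n_gt0).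

Lemma cyc_ordS j : ordS (cyc j) = cyc j.+1.
Proof. by apply: val_inj; rewrite /= -addn1 modnDml addn1. Qed.

Lemma cyc_ord_pred j : ord_pred (cyc j.+1) = cyc j.
Proof. by rewrite -cyc_ordS ordSK. Qed.

Lemma cyc_period j : cyc (j + 3 * k) = cyc j.
Proof. by apply: val_inj; rewrite /= modnDr. Qed.

Lemma cyc_ord (x : 'I_(3 * k)) : cyc x = x.
Proof. by apply: val_inj; rewrite /= modn_small. Qed.

Lemma cyc_block i r : r < 3 -> cyc (3 * i + r) = 3 * (i %% k) + r :> nat.
Proof.
move=> r3; have i_lt : i %% k < k by rewrite ltn_mod.
have -> : 3 * i + r = i %/ k * (3 * k) + (3 * (i %% k) + r).
  by rewrite {1}(divn_eq i k); lia.
by rewrite /= modnMDl modn_small; lia.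
Qed.

Lemma b_nth_lt3 r : r < 3 -> nth 0 b r < 3.
Proof. by move=> r3; apply: (allP b_lt3); rewrite mem_nth ?b_size. Qed.

Lemma f_cyc i r : r < 3 -> f (cyc (3 * i + r)) = cyc (3 * i + nth 0 b r).
Proof.
move=> r3; apply: ord_inj; rewrite fb cyc_block // cyc_block ?b_nth_lt3 //.
by rewrite mod3_block // div3_block // addnC.
Qed.

Section VertexSet.
Variable D : {set cycle_functigraph f}.

Definition inU j : bool := inl (cyc j) \in D.
Definition inV j : bool := inr (cyc j) \in D.

Definition covered (v : cycle_functigraph f) :=
  (v \in D) || [exists u in D, sedge u v].

Lemma covered_inl (x : 'I_(3 * k)) : covered (inl x) =
  [|| inl (ord_pred x) \in D, inl x \in D, inl (ordS x) \in D
    | inr (f x) \in D].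
Proof.
rewrite /covered; apply/idP/idP.
  case/orP=> [->|/exists_inP[[u|u] uD /=]]; rewrite ?orbT //.
    by rewrite cycle_relE // => /orP[]/eqP<-; rewrite uD ?orbT.
  by move/eqP<-; rewrite uD !orbT.
case/or4P=> [xD|->//|xD|xD]; apply/orP; right; apply/exists_inP.
- by exists (inl (ord_pred x)); rewrite //= cycle_relE // eqxx.
- by exists (inl (ordS x)); rewrite //= cycle_relE // eqxx orbT.
- by exists (inr (f x)); rewrite /=.
Qed.

Lemma covered_inr (y : 'I_(3 * k)) : covered (inr y) =
  [|| inr (ord_pred y) \in D, inr y \in D, inr (ordS y) \in D
    | [exists x, (f x == y) && (inl x \in D)]].
Proof.
rewrite /covered; apply/idP/idP.
  case/orP=> [->|/exists_inP[[u|u] uD /=]]; rewrite ?orbT //.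
    move/eqP=> yE; apply/or4P/Or44/existsP.
    by exists u; rewrite yE eqxx uD.
  by rewrite cycle_relE // => /orP[]/eqP<-; rewrite uD ?orbT.
case/or4P=> [xD|->//|xD|/existsP[x /andP[/eqP<- xD]]].
- apply/orP; right; apply/exists_inP.
  by exists (inr (ord_pred y)); rewrite //= cycle_relE // eqxx.
- apply/orP; right; apply/exists_inP.
  by exists (inr (ordS y)); rewrite //= cycle_relE // eqxx orbT.
- by apply/orP; right; apply/exists_inP; exists (inl x); rewrite /=.
Qed.

(* Position [t] of the window is the vertex of index 3i + 2 + t, so that
   positions 1, 2, 3 form block i + 1. *)
Definition window (p : nat -> bool) i := mkseq (fun t => p (3 * i + 2 + t)) 5.

(** All neighbours of a vertex of block i + 1 lie in the window, because its image and its preimages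
    under [f] are in the block of the same index. *)
Lemma window_dominated i :
  block_dominated b (window inU i) (window inV i) =
  all (fun r => covered (inl (cyc (3 * i.+1 + r))) &&
                covered (inr (cyc (3 * i.+1 + r)))) (iota 0 3).
Proof.
apply: eq_in_all => r; rewrite mem_iota add0n => /andP[_ r3].
have b3 := b_nth_lt3 r3.
have w p t : t < 5 -> nth false (window p i) t = p (3 * i + 2 + t).
  by move=> t5; rewrite nth_mkseq.
have E t : 3 * i + 2 + t.+1 = 3 * i.+1 + t by lia.
rewrite covered_inl covered_inr (f_cyc _ r3).
have [r_lt r1_lt r2_lt br_lt] :
  [/\ r < 5, r.+1 < 5, r.+2 < 5 & (nth 0 b r).+1 < 5] by split; lia.
rewrite !(w _ r) // !(w _ r.+1) // !(w _ r.+2) // !(w _ (nth 0 b r).+1) //.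
rewrite cyc_ordS -addnS -!E [3 * i + 2 + r.+1]addnS cyc_ord_pred -addnS.
congr (_ && [|| _, _, _ | _]).
apply/hasP/existsP=> [[t]|[x /andP[/eqP fx xD]]].
  rewrite mem_iota add0n => /andP[_ t3] /andP[/eqP bt].
  rewrite w; last by lia.
  rewrite E => tD; exists (cyc (3 * i.+1 + t)).
  by rewrite f_cyc // bt E eqxx.
(* A preimage [x] has the same quotient by 3 as its image, hence is determined by its position in
   the block. *)
have m3 : x %% 3 < 3 by rewrite ltn_mod.
exists (x %% 3); first by rewrite mem_iota.
have := congr1 (@nat_of_ord _) fx; rewrite fb E cyc_block // => xE.
have n3 := b_nth_lt3 m3.
have -> : nth 0 b (x %% 3) == r by lia.
rewrite w; last by lia.
rewrite E /inU; suff -> : cyc (3 * i.+1 + x %% 3) = x by [].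
by apply: ord_inj; rewrite cyc_block //; have := divn_eq x 3; lia.
Qed.

Lemma dominating_windows :
  dominating D <-> forall i, block_dominated b (window inU i) (window inV i).
Proof.
split=> [/forallP domD i|wD].
  by rewrite window_dominated; apply/allP=> r _; rewrite /covered !domD.
apply/forallP=> v; rewrite -/(covered v).
suff cD x : covered (inl x) && covered (inr x).
  by case: v => x; case/andP: (cD x).
have m3 : x %% 3 < 3 by rewrite ltn_mod.
(* Adding k keeps the predecessor of the block index meaningful for block 0. *)
have -> : x = cyc (3 * (x %/ 3 + k).-1.+1 + x %% 3).
  rewrite prednK; last by lia.
  have -> : 3 * (x %/ 3 + k) + x %% 3 = x + 3 * k by have := divn_eq x 3; lia.
  by rewrite cyc_period cyc_ord.
have := wD (x %/ 3 + k).-1; rewrite window_dominated => /allP.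
by apply; rewrite mem_iota.
Qed.

(** * Bounds on the domination number obtained block by block *)

Definition block_weight i : nat :=
  inU (3 * i) + inU (3 * i + 1) + inU (3 * i + 2) +
  (inV (3 * i) + inV (3 * i + 1) + inV (3 * i + 2)).

Lemma sum_blocks (F : nat -> nat) :
  \sum_(j < 3 * k) F j =
  \sum_(i < k) (F (3 * i) + F (3 * i + 1) + F (3 * i + 2)).
Proof.
elim: (k) => [|m IHm]; first by rewrite !big_ord0.
have -> : 3 * m.+1 = (3 * m).+3 by lia.
rewrite !big_ord_recr /= -IHm.
by rewrite addn1 addn2 !addnA.
Qed.

Lemma card_block_weight : #|D| = \sum_(i < k) block_weight i.
Proof.
rewrite big_split /= -(sum_blocks inU) -(sum_blocks inV).
rewrite -sum1_card big_sumType /=.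
congr (_ + _); rewrite big_mkcond /=; apply: eq_bigr => x _.
  by rewrite /inU cyc_ord; case: (_ \in _).
by rewrite /inV cyc_ord; case: (_ \in _).
Qed.

End VertexSet.

Lemma sum_shift_periodic (F : nat -> nat) :
  F k = F 0 -> \sum_(i < k) F i.+1 = \sum_(i < k) F i.
Proof.
move=> Fk; have : \sum_(i < k.+1) F i = F 0 + \sum_(i < k) F i.+1.
  by rewrite big_ord_recl.
by rewrite big_ord_recr /= Fk addnC => /addnI.
Qed.

(* [phi] is a potential on the cuts between consecutive blocks: its arguments
   say whether the last vertices of the left block and the first vertices of the
   right block belong to the dominating set. *)
Lemma potential_leq_domination_number
    (phi : bool -> bool -> bool -> bool -> nat) :
  (forall p0 p1 p2 p3 p4 q0 q1 q2 q3 q4 : bool,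
     block_dominated b [:: p0; p1; p2; p3; p4] [:: q0; q1; q2; q3; q4] ->
     2 + phi p3 q3 p4 q4 <= p1 + p2 + p3 + (q1 + q2 + q3) + phi p0 q0 p1 q1) ->
  2 * k <= domination_number (cycle_functigraph f).
Proof.
move=> phiP.
have [D domD <-] := domination_number_witness (cycle_functigraph f).
have wD := (dominating_windows D).1 domD.
pose cut i := phi (inU D (3 * i + 2)) (inV D (3 * i + 2))
                  (inU D (3 * i.+1)) (inV D (3 * i.+1)).
have step i : 2 + cut i.+1 <= block_weight D i.+1 + cut i.
  have E t : 3 * i + 2 + t.+1 = 3 * i.+1 + t by lia.
  have := wD i; rewrite /window /mkseq /= addn0 !E addn0 => /phiP.
  by have -> : 3 * i.+1 + 3 = 3 * i.+2 by lia.
have periodU j : inU D (3 * k + j) = inU D j by rewrite /inU addnC cyc_period.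
have periodV j : inV D (3 * k + j) = inV D j by rewrite /inV addnC cyc_period.
have cutk : cut k = cut 0.
  by rewrite /cut mulnS addnC muln0 !(addnC _ (3 * k)) !periodU !periodV.
have weightk : block_weight D k = block_weight D 0.
  have := periodU 0; have := periodV 0; rewrite addn0 => V0 U0.
  by rewrite /block_weight !periodU !periodV U0 V0.
(* Summing over one turn of the cycle, the potentials on both sides cancel and the weights add up to
   the cardinality of [D]. *)
have : \sum_(i < k) (2 + cut i.+1)
       <= \sum_(i < k) (block_weight D i.+1 + cut i).
  by apply: leq_sum => i _; exact: step.
rewrite big_split [leqRHS]big_split /= sum_nat_const card_ord.
rewrite (sum_shift_periodic cutk) (sum_shift_periodic weightk).
by rewrite leq_add2r -card_block_weight mulnC.
Qed.

(* A block of a vertex set is given by the positions 0, 1, 2 that it occupies in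
   the first and in the second cycle. *)
Definition triple_dominated (x y z : seq nat * seq nat) : bool :=
  block_dominated b
    [:: 2 \in x.1; 0 \in y.1; 1 \in y.1; 2 \in y.1; 0 \in z.1]
    [:: 2 \in x.2; 0 \in y.2; 1 \in y.2; 2 \in y.2; 0 \in z.2].

Definition weight (x : seq nat * seq nat) : nat :=
  (0 \in x.1) + (1 \in x.1) + (2 \in x.1) +
  ((0 \in x.2) + (1 \in x.2) + (2 \in x.2)).

(** The triple starting at i tests its middle block, so the k cyclic triples test every block. *)
Lemma domination_number_leq_blocks (m : nat -> seq nat * seq nat) :
  (forall i, i < k -> triple_dominated (m i) (m (i.+1 %% k)) (m (i.+2 %% k))) ->
  domination_number (cycle_functigraph f) <= \sum_(i < k) weight (m i).
Proof.
move=> mP.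
pose D : {set cycle_functigraph f} := [set v |
  match v : 'I_(3 * k) + 'I_(3 * k) with
  | inl x => x %% 3 \in (m (x %/ 3)).1
  | inr x => x %% 3 \in (m (x %/ 3)).2 end].
have DU i r : r < 3 -> inU D (3 * i + r) = (r \in (m (i %% k)).1).
  by move=> r3; rewrite /inU inE cyc_block // div3_block // mod3_block.
have DV i r : r < 3 -> inV D (3 * i + r) = (r \in (m (i %% k)).2).
  by move=> r3; rewrite /inV inE cyc_block // div3_block // mod3_block.
have -> : \sum_(i < k) weight (m i) = #|D|.
  rewrite card_block_weight; apply: eq_bigr => i _.
  have := DU i 0 isT; have := DV i 0 isT; rewrite addn0 => V0 U0.
  by rewrite /block_weight U0 V0 !DU ?DV // modn_small.
apply: domination_number_leq; apply/dominating_windows => i.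
have E t : 3 * i + 2 + t.+1 = 3 * i.+1 + t by lia.
rewrite /window /mkseq /= addn0 !E.
have -> : 3 * i.+1 + 3 = 3 * i.+2 + 0 by lia.
rewrite !DU // !DV //; have := mP (i %% k); rewrite ltn_mod => /(_ k_gt0).
by rewrite -[(i %% k).+2]addn2 -[(i %% k).+1]addn1 !modnDml addn1 addn2.
Qed.

(** The nine triples include all those occurring in the cyclic word [m0 m1 m2 m ... m] for any k at
    least 3; the first three settle k = 3. *)
Lemma domination_number_leq_pattern (m0 m1 m2 m : seq nat * seq nat) :
  3 <= k ->
  all (fun t => triple_dominated t.1.1 t.1.2 t.2)
    [:: (m0, m1, m2); (m1, m2, m0); (m2, m0, m1); (m1, m2, m); (m2, m, m);
        (m2, m, m0); (m, m, m); (m, m, m0); (m, m0, m1)] ->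
  domination_number (cycle_functigraph f) <=
  weight m0 + weight m1 + weight m2 + (k - 3) * weight m.
Proof.
move=> k_ge3 /=.
case/and5P=> d012 d120 d201 d12m /and5P[d2mm d2m0 dmmm dmm0 /andP[dm01 _]].
pose s i := nth m [:: m0; m1; m2] i.
have -> : weight m0 + weight m1 + weight m2 + (k - 3) * weight m
          = \sum_(i < k) weight (s i).
  have -> : \sum_(i < k) weight (s i) = \sum_(i < 3 + (k - 3)) weight (s i).
    by rewrite subnKC.
  rewrite !big_ord_recl !addnA; congr (_ + _).
  by under eq_bigr do rewrite /s /= nth_nil; rewrite sum_nat_const card_ord.
apply: domination_number_leq_blocks => i i_lt.
have s3 j : 3 <= j -> s j = m.
  by case: j => [|[|[|j]]] //= _; rewrite /s /= nth_nil.
(* The triple does not wrap around, or its last block does, or its last two blocks do. *)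
have [i2|[iE|iE]] : i.+2 < k \/ i.+2 = k \/ i.+1 = k.
  by clear -i_lt; lia.
- rewrite !modn_small //; last exact: ltnW.
  case: i {i_lt i2} => [|[|[|i]]] //.
  by rewrite !s3.
- rewrite iE modnn modn_small; last by rewrite -iE.
  case: i i_lt iE => [|[|[|i]]] i_lt iE //; first by rewrite -iE in k_ge3.
  by rewrite (s3 i.+3) // (s3 i.+4).
rewrite iE modnn -addn1 modnDl modn_small ?(ltn_trans _ k_ge3) //.
case: i i_lt iE => [|[|[|i]]] i_lt iE //; try by rewrite -iE in k_ge3.
by rewrite s3.
Qed.

End Domination.

(** * The domination number of a cycle of length 3k *)

Lemma domination_number_cycle k : 0 < k ->
  domination_number (cycle_graph (3 * k)) = k.
Proof.
move=> k_gt0; have n1 : 1 < 3 * k by lia.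
apply/eqP; rewrite eqn_leq; apply/andP; split.
  (* Upper bound: the middle vertices of the blocks dominate. *)
  have lt i : i < k -> 3 * i + 1 < 3 * k by lia.
  pose c (i : 'I_k) : 'I_(3 * k) := Ordinal (lt i (ltn_ord i)).
  have c_inj : injective c.
    by move=> i j /(congr1 val) /= ij; apply: val_inj => /=; lia.
  rewrite -[leqRHS]card_ord -cardsT -(card_imset _ c_inj).
  apply: domination_number_leq; apply/forallP=> v.
  have v_lt := ltn_ord v; have vE := divn_eq v 3.
  have q_lt : v %/ 3 < k by lia.
  have r3 : v %% 3 < 3 by rewrite ltn_mod.
  have cD : c (Ordinal q_lt) \in c @: [set: 'I_k] by rewrite imset_f ?inE.
  have [r1|r1] := eqVneq (v %% 3) 1.
    suff -> : v = c (Ordinal q_lt) by rewrite cD.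
    by apply: val_inj => /=; lia.
  apply/orP; right; apply/exists_inP; exists (c (Ordinal q_lt)) => //=.
  rewrite /cycle_rel -!val_eqE /=.
  have [r0|r2] : v %% 3 = 0 \/ v %% 3 = 2 by lia.
    by rewrite (@modn_small v.+1); lia.
  by rewrite modn_small; lia.
have [D domD <-] := domination_number_witness (cycle_graph (3 * k)).
(* Double counting: every vertex is dominated by some [u] in [D], and such a [u] dominates only
   itself and its two neighbours. *)
have : #|'I_(3 * k)| <= \sum_(u in D) 3.
  rewrite -sum1_card; apply: leq_trans (_ : \sum_(v < 3 * k) \sum_(u in D)
    ((v == u) + (v == ordS u) + (v == ord_pred u)) <= _).
    apply: leq_sum => v _; have /orP[vD|/exists_inP[u uD]] := forallP domD v.
      by rewrite (bigD1 v) //= eqxx.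
    rewrite /= cycle_relE // => uv.
    rewrite (bigD1 u) //=; case/orP: uv => /eqP uv.
      by rewrite uv ord_predK eqxx; case: (_ == _).
    have -> : (v == ord_pred u) = true by rewrite uv ordSK eqxx.
    by rewrite addn1 addSn.
  rewrite exchange_big; apply: leq_sum => u _.
  have one (w : 'I_(3 * k)) : \sum_(v < 3 * k) (v == w) = 1.
    by rewrite (bigD1 w) //= eqxx big1 // => v /negPf->.
  by rewrite !big_split /= !one.
by rewrite card_ord sum_nat_const; lia.
Qed.

(** * Lower and upper bounds for the individual block forms *)

Section Bounds.
Variables (k : nat) (f : 'I_(3 * k) -> 'I_(3 * k)).
Hypothesis k_ge3 : 3 <= k.

Let k_gt0 : 0 < k. Proof. by lia. Qed.

(* The potentials below were found by a shortest-path search in the graph of block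
   transitions, where crossing a block of weight w costs w - 2. *)
Lemma domination_number_geq_112 :
  blockwise [:: 0; 0; 1] f -> 2 * k <= domination_number (cycle_functigraph f).
Proof.
move=> fb; apply: (@potential_leq_domination_number _ k_gt0 _ f _ _ fb
  (fun lu lv ru rv => lu + ~~ [&& ~~ lv, rv & lu || ru])) => //.
(* The inequality is checked on all 1024 memberships of a window. *)
by do 10![case].
Qed.

Lemma domination_number_geq_121 :
  blockwise [:: 0; 1; 0] f -> 2 * k <= domination_number (cycle_functigraph f).
Proof.
move=> fb; apply: (@potential_leq_domination_number _ k_gt0 _ f _ _ fb
  (fun lu lv ru rv => [&& lu || lv, ~~ ru & ~~ rv])) => //.
by do 10![case].
Qed.

Lemma domination_number_geq_131 :
  blockwise [:: 0; 2; 0] f -> 2 * k <= domination_number (cycle_functigraph f).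
Proof.
move=> fb; apply: (@potential_leq_domination_number _ k_gt0 _ f _ _ fb
  (fun lu lv ru rv => [&& lu, ~~ ru & ~~ rv])) => //.
by do 10![case].
Qed.

(** The middle vertices of all blocks dominate each cycle separately, whatever [f] is. *)
Lemma domination_number_leq_double (b0 b1 b2 : nat) :
  b0 < 3 -> b1 < 3 -> b2 < 3 -> blockwise [:: b0; b1; b2] f ->
  domination_number (cycle_functigraph f) <= 2 * k.
Proof.
move=> b0P b1P b2P fb; pose m := ([:: 1], [:: 1]).
apply: leq_trans (_ : weight m + weight m + weight m + (k - 3) * weight m <= _).
  apply: (@domination_number_leq_pattern _ k_gt0 _ f _ _ fb m m m m k_ge3)
    => //=.
    by rewrite b0P b1P b2P.
by rewrite /weight /=; lia.
Qed.

(** For constant values, the image vertex alone is taken in each block. In the other six cases a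
    block normally takes the two image vertices. The block [m1] instead takes one of them and an end
    vertex of the first cycle; the latter dominates, across a cut, the one vertex of a neighbouring
    block whose image can then be dropped. This saves one vertex. *)
Lemma domination_number_lt_double (b : seq nat) :
  blockwise b f ->
  b \in [:: [:: 0; 0; 0]; [:: 1; 1; 1]; [:: 2; 2; 2]; [:: 1; 0; 0];
            [:: 1; 1; 0]; [:: 2; 0; 0]; [:: 2; 1; 1]; [:: 2; 2; 0];
            [:: 2; 2; 1]] ->
  domination_number (cycle_functigraph f) < 2 * k.
Proof.
move=> fb b_in.
have sz : size b = 3 by move: b_in; do 9![case/predU1P=> [->//|]].
have b3 : all (gtn 3) b by move: b_in; do 9![case/predU1P=> [->//|]].
have bound m0 m1 m2 m :
  all (fun t => triple_dominated b t.1.1 t.1.2 t.2)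
    [:: (m0, m1, m2); (m1, m2, m0); (m2, m0, m1); (m1, m2, m); (m2, m, m);
        (m2, m, m0); (m, m, m); (m, m, m0); (m, m0, m1)] ->
  weight m0 + weight m1 + weight m2 <= 5 -> weight m <= 2 ->
  domination_number (cycle_functigraph f) < 2 * k.
  move=> /(domination_number_leq_pattern k_gt0 sz b3 fb k_ge3) le w5 w2.
  by apply: leq_ltn_trans le _; have := leq_mul (leqnn (k - 3)) w2; lia.
move: b_in bound {fb sz b3}.
case/predU1P=> [->|].
  by move/(_ ([::], [:: 0]) ([::], [:: 0])
            ([::], [:: 0]) ([::], [:: 0])); exact.
case/predU1P=> [->|].
  by move/(_ ([::], [:: 1]) ([::], [:: 1])
            ([::], [:: 1]) ([::], [:: 1])); exact.
case/predU1P=> [->|].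
  by move/(_ ([::], [:: 2]) ([::], [:: 2])
            ([::], [:: 2]) ([::], [:: 2])); exact.
case/predU1P=> [->|].
  by move/(_ ([::], [:: 0; 1]) ([:: 2], [:: 1])
            ([::], [:: 0]) ([::], [:: 0; 1])); exact.
case/predU1P=> [->|].
  by move/(_ ([::], [:: 1]) ([:: 0], [:: 0])
            ([::], [:: 0; 1]) ([::], [:: 0; 1])); exact.
case/predU1P=> [->|].
  by move/(_ ([::], [:: 0; 2]) ([:: 2], [:: 2])
            ([::], [:: 0]) ([::], [:: 0; 2])); exact.
case/predU1P=> [->|].
  by move/(_ ([::], [:: 1; 2]) ([:: 2], [:: 2])
            ([::], [:: 1]) ([::], [:: 1; 2])); exact.
case/predU1P=> [->|].
  by move/(_ ([::], [:: 2]) ([:: 0], [:: 0])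
            ([::], [:: 0; 2]) ([::], [:: 0; 2])); exact.
case/predU1P=> [->|].
  by move/(_ ([::], [:: 2]) ([:: 0], [:: 1])
            ([::], [:: 1; 2]) ([::], [:: 1; 2])); exact.
by [].
Qed.

End Bounds.

(** * Isomorphism classes of the remaining block forms *)

Section Classes.
Variables (k : nat) (f : 'I_(3 * k) -> 'I_(3 * k)).
Hypothesis k_gt0 : 0 < k.

Local Notation tt := (@three_translate_of k).
Local Notation cf := cycle_functigraph.

(** With values shifted down by one, the moves from 001 are: shift to 112, reflect to 011, shift to
    122; and rotate to 022, reflect to 002. *)
Lemma blockwise_iso_112 (b : seq nat) :
  b \in [:: [:: 0; 0; 1]; [:: 1; 1; 2]; [:: 0; 1; 1]; [:: 1; 2; 2];
            [:: 0; 2; 2]; [:: 0; 0; 2]] ->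
  blockwise b f ->
  sgraph_iso (cf f) (cf (tt 1 1 2)).
Proof.
move=> b_in fb; apply: sgraph_iso_sym.
(* Chains of moves pass through intermediate forms, so concrete maps realizing these are fixed
   first. *)
have t112 : blockwise [:: 0; 0; 1] (tt 1 1 2)
  by exact: three_translate_of_blockwise.
have t223 : blockwise [:: 1; 1; 2] (tt 2 2 3)
  by exact: three_translate_of_blockwise.
have t122 : blockwise [:: 0; 1; 1] (tt 1 2 2)
  by exact: three_translate_of_blockwise.
have t133 : blockwise [:: 0; 2; 2] (tt 1 3 3)
  by exact: three_translate_of_blockwise.
have i223 : sgraph_iso (cf (tt 1 1 2)) (cf (tt 2 2 3)).
  exact (@blockwise_iso_shift k k_gt0 0 0 1 _ _ isT isT isT t112 t223).
have i122 : sgraph_iso (cf (tt 1 1 2)) (cf (tt 1 2 2)).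
  exact (sgraph_iso_trans i223
    (@blockwise_iso_rev k k_gt0 1 1 2 _ _ isT isT isT t223 t122)).
have i133 : sgraph_iso (cf (tt 1 1 2)) (cf (tt 1 3 3)).
  exact (blockwise_iso_rot k_gt0 t112 t133).
case/predU1P: b_in fb => [-> fb|]; first exact (blockwise_iso_eq t112 fb).
case/predU1P=> [-> fb|]; first
  exact (@blockwise_iso_shift k k_gt0 0 0 1 _ _ isT isT isT t112 fb).
case/predU1P=> [-> fb|].
  exact (sgraph_iso_trans i223
    (@blockwise_iso_rev k k_gt0 1 1 2 _ _ isT isT isT t223 fb)).
case/predU1P=> [-> fb|].
  exact (sgraph_iso_trans i122
    (@blockwise_iso_shift k k_gt0 0 1 1 _ _ isT isT isT t122 fb)).
case/predU1P=> [-> fb|]; first exact (blockwise_iso_rot k_gt0 t112 fb).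
case/predU1P=> [-> fb|//]; exact (sgraph_iso_trans i133
    (@blockwise_iso_rev k k_gt0 0 2 2 _ _ isT isT isT t133 fb)).
Qed.

(** From 010, a shift gives 121, whose reflection is 101; the reflection of 010 itself is 212. *)
Lemma blockwise_iso_121 (b : seq nat) :
  b \in [:: [:: 0; 1; 0]; [:: 1; 2; 1]; [:: 1; 0; 1]; [:: 2; 1; 2]] ->
  blockwise b f ->
  sgraph_iso (cf f) (cf (tt 1 2 1)).
Proof.
move=> b_in fb; apply: sgraph_iso_sym.
have t121 : blockwise [:: 0; 1; 0] (tt 1 2 1)
  by exact: three_translate_of_blockwise.
have t232 : blockwise [:: 1; 2; 1] (tt 2 3 2)
  by exact: three_translate_of_blockwise.
have i232 : sgraph_iso (cf (tt 1 2 1)) (cf (tt 2 3 2)).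
  exact (@blockwise_iso_shift k k_gt0 0 1 0 _ _ isT isT isT t121 t232).
case/predU1P: b_in fb => [-> fb|]; first exact (blockwise_iso_eq t121 fb).
case/predU1P=> [-> fb|]; first
  exact (@blockwise_iso_shift k k_gt0 0 1 0 _ _ isT isT isT t121 fb).
case/predU1P=> [-> fb|].
  exact (sgraph_iso_trans i232
    (@blockwise_iso_rev k k_gt0 1 2 1 _ _ isT isT isT t232 fb)).
case/predU1P=> [-> fb|//].
exact (@blockwise_iso_rev k k_gt0 0 1 0 _ _ isT isT isT t121 fb).
Qed.

Lemma blockwise_iso_131 (b : seq nat) :
  b \in [:: [:: 0; 2; 0]; [:: 2; 0; 2]] -> blockwise b f ->
  sgraph_iso (cf f) (cf (tt 1 3 1)).
Proof.
move=> b_in fb; apply: sgraph_iso_sym.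
have t131 : blockwise [:: 0; 2; 0] (tt 1 3 1)
  by exact: three_translate_of_blockwise.
case/predU1P: b_in fb => [-> fb|]; first exact (blockwise_iso_eq t131 fb).
case/predU1P=> [-> fb|//].
exact (@blockwise_iso_rev k k_gt0 0 2 0 _ _ isT isT isT t131 fb).
Qed.

End Classes.

(** * Classification over the 27 block forms *)

Theorem theorem4p14 (k : nat) (f : 'I_(3 * k) -> 'I_(3 * k)) :
  3 <= k -> three_translate f -> ~ bijective f ->
  (domination_number (cycle_functigraph f) = 2 * k /\
   2 * k = 2 * domination_number (cycle_graph (3 * k)))
  <->
  [\/ sgraph_iso (cycle_functigraph f)
        (cycle_functigraph (@three_translate_of k 1 1 2)),
      sgraph_iso (cycle_functigraph f)
        (cycle_functigraph (@three_translate_of k 1 2 1))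
    | sgraph_iso (cycle_functigraph f)
        (cycle_functigraph (@three_translate_of k 1 3 1))].
Proof.
move=> k_ge3 ft f_nbij; have k_gt0 : 0 < k by lia.
have [b0 [b1 [b2 [b0P b1P b2P fb]]]] := blockwise_three_translate ft.
rewrite domination_number_cycle //.
have t112 := @three_translate_of_blockwise k 1 1 2 isT isT isT.
have t121 := @three_translate_of_blockwise k 1 2 1 isT isT isT.
have t131 := @three_translate_of_blockwise k 1 3 1 isT isT isT.
split=> [[gf _]|iso]; last first.
  split=> //; apply/eqP.
  rewrite eqn_leq (domination_number_leq_double k_ge3 _ _ _ fb) //=.
  (* The lower bound is transported from the representative of the class. *)
  case: iso => /domination_number_iso ->.
  - exact: domination_number_geq_112 t112.
  - exact: domination_number_geq_121 t121.
  - exact: domination_number_geq_131 t131.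
(* Domination number 2k excludes the nine forms with a smaller dominating set. *)
have not_sparse := contraNN (domination_number_lt_double k_ge3 fb).
rewrite gf ltnn in not_sparse; have {}not_sparse := not_sparse isT.
have not_uniq : ~~ uniq [:: b0; b1; b2].
  apply/negP=> b_uniq; apply/f_nbij/injF_bij.
  by apply: (blockwise_inj fb) => //=; rewrite b0P b1P b2P.
(* Of the 27 forms, 6 are permutations and 9 have a smaller dominating set; the other 12 fall into
   classes of 6, 4 and 2. *)
have classes : [|| [:: b0; b1; b2] \in [:: [:: 0; 0; 1]; [:: 1; 1; 2];
      [:: 0; 1; 1]; [:: 1; 2; 2]; [:: 0; 2; 2]; [:: 0; 0; 2]],
    [:: b0; b1; b2] \in [:: [:: 0; 1; 0]; [:: 1; 2; 1]; [:: 1; 0; 1];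
      [:: 2; 1; 2]]
  | [:: b0; b1; b2] \in [:: [:: 0; 2; 0]; [:: 2; 0; 2]]].
  move: not_sparse not_uniq {fb}.
  by move: b0 b1 b2 b0P b1P b2P => [|[|[|//]]] [|[|[|//]]] [|[|[|//]]].
case/or3P: classes => [b_in|b_in|b_in].
- by constructor 1; apply: blockwise_iso_112 b_in fb.
- by constructor 2; apply: blockwise_iso_121 b_in fb.
- by constructor 3; apply: blockwise_iso_131 b_in fb.
Qed.
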